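(* Let $(X,|\cdot|)$ be a Banach space, let $K\subset X$ be a non-degenerate cone, let $T\colon K\to K$ be completely continuous, and let $\mathcal{F}\colon K\times K\to\mathbb{R}$ be a continuous functional such that for any $u\in K\setminus\{0\}$ and $\lambda>0$ one has $\mathcal{F}(\lambda u,u)=0$ if and only if $\lambda=1$. Assume that: (c1) for every $u\in K\setminus\{0\}$ there exists a unique number $s(u)>0$ such that $\mathcal{F}\bigl(T(s(u)u),\,s(u)u\bigr)=0$; (c2) there exist $0<m<M<\infty$ such that $\inf_{S^1_K}s(\cdot)>m$ and $\sup_{S^1_K}s(\cdot)<M$, where $S^1_K:=\{u\in K:|u|=1\}$. Then the operator $T$ has a fixed point $u\in K$. In addition, if $0$ is not a solution of $T(u)=u$, then $s(u)=1$.
   Context: A non-degenerate cone in a Banach space is a closed, convex set $K$ with $\lambda K\subset K$ for all $\lambda\in\mathbb{R}_+=[0,\infty)$ and $K\setminus\{0\}\neq\emptyset$. An operator is completely continuous if it is continuous and maps bounded sets into relatively compact sets. *)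

(* Defs.v *)
From mathcomp Require Export all_boot all_order all_algebra.
From mathcomp Require Export all_classical all_reals all_analysis.
Export numFieldNormedType.Exports.

Set Implicit Arguments.
Unset Strict Implicit.
Unset Printing Implicit Defensive.

Import Order.TTheory GRing.Theory Num.Theory.
Local Open Scope classical_set_scope.
Local Open Scope ring_scope.

(* No pointedness (K `&` -K = 0) is required of a cone. *)
Definition nondegenerate_cone (R : realType) (X : normedModType R)
    (K : set X) : Prop :=
  [/\ closed K,
      convex_set (K : set (convex_lmodType X)),
      (forall (l : R) (u : X), 0 <= l -> K u -> K (l *: u)) &
      K `\ 0 !=set0].

(* T is only meaningful on D: continuity is for the subspace topology of D and
   only the bounded subsets of D are considered. *)
Definition completely_continuous_on (R : realType) (X Y : normedModType R)
    (D : set X) (T : X -> Y) : Prop :=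
  {within D, continuous T} /\
  (forall B : set X, B `<=` D -> bounded_set B -> precompact (T @` B)).

Definition cone_sphere (R : realType) (X : normedModType R) (K : set X) :
    set X :=
  [set u | K u /\ `|u| = 1].

(* Main.v *)
Require Import Defs.
From mathcomp Require Import finmap zify ring lra.

(** Rescaling gives [s (a *: u) = s u / a], and the bounds (c2) together
    with the uniqueness in (c1) make [s] continuous on [K `\ 0].
    Hence [rho v := min 1 (s v) *: v] is a continuous retraction of [K] onto a
    bounded set, and Schauder's theorem gives [v] with [T (rho v) = v]. If [rho]
    moved [v], then [u := s v *: v] would satisfy [F (T u, u) = 0] and
    [T u = (s v)^-1 *: u] with [s v < 1], against the hypothesis on [F]; so
    [T v = v].

    Schauder's theorem follows from Brouwer's on the simplex by projecting onto
    the convex hull of a finite net. Brouwer's theorem is obtained from Scarf's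
    combinatorial lemma for several linear orders on a finite set, applied to
    the grid points of the simplex ordered by each of their coordinates: no
    triangulation is needed. *)

Set Implicit Arguments.
Unset Strict Implicit.
Unset Printing Implicit Defensive.

Import Order.TTheory GRing.Theory Num.Theory.

(** * Scarf's lemma *)

Lemma odd_sum (J : finType) (P : pred J) (f : J -> nat) :
  odd (\sum_(j | P j) f j) = \big[addb/false]_(j | P j) odd (f j).
Proof. exact: (big_morph odd oddD). Qed.

Section scarf_parity.
Variables (Y I : finType) (r : I -> Y -> nat) (e : I -> Y) (c : Y -> I).
(* [r i] ranks [Y] for the [i]-th linear order; [e i] is the slack element of
   colour [i], smallest for [i] and above all non-slacks for the others. *)
Hypothesis rinj : forall i, injective (r i).
Hypothesis e_min : forall i y, r i (e i) <= r i y.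
Hypothesis e_max : forall i j y, j != i -> y \notin codom e ->
  r i y <= r i (e j).
Hypothesis ce : cancel e c.

(** Dominant sets take the place of the simplices of a triangulation: for nonempty [S], no element
    lies strictly above the minimum of [S] in every order. *)
Definition dominant (S : {set Y}) :=
  [forall y, exists i, forall s in S, r i y <= r i s].

Lemma dominantP (S : {set Y}) :
  reflect (forall y, exists i, {in S, forall s, r i y <= r i s}) (dominant S).
Proof.
apply: (iffP forallP) => dS y.
  by have /existsP[i /forall_inP h] := dS y; exists i.
by apply/existsP; have [i h] := dS y; exists i; apply/forall_inP.
Qed.

Lemma sub_dominant (S R : {set Y}) : S \subset R -> dominant R -> dominant S.
Proof.
move=> /fintype.subsetP SR /dominantP dR; apply/dominantP => y.
by have [i h] := dR y; exists i => s /SR; exact: h.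
Qed.

Variable i0 : I.

(* Every room has an even number of doors unless it is fully coloured, and every
   door an even number of rooms unless it is [S0], the set of all slacks but
   [e i0]; counting incidences mod 2 gives a fully coloured room. *)
Definition door (S : {set Y}) :=
  [&& dominant S, c @: S == [set~ i0] & #|S| == #|I|.-1].

Definition room (R : {set Y}) := dominant R && (#|R| == #|I|).

(** In a fully coloured [R] colours do not repeat, so only the element of colour [i0] can be
    removed. Otherwise, if removing [x] works, the colour of [x] occurs at exactly one other element
    [x'], and [x] and [x'] are the only choices. *)
Lemma odd_doors_of_room (R : {set Y}) : #|R| = #|I| ->
  odd #|[set x in R | c @: (R :\ x) == [set~ i0]]| = (c @: R == [set: I]).
Proof.
move=> cR; have [full|nfull] := eqVneq.
  have injc : {in R &, injective c}.
    by apply/imset_injP; rewrite full cardsT cR.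
  have /imsetP[x xR i0x] : i0 \in c @: R by rewrite full inE.
  rewrite (_ : [set _ in R | _] = [set x]) ?cards1//.
  apply/setP => y; rewrite !inE; apply/andP/eqP => [[yR /eqP h]|->].
    apply/eqP; apply: contraT => nyx.
    have : i0 \in c @: (R :\ y).
      by rewrite i0x imset_f// !inE eq_sym nyx.
    by rewrite h !inE eqxx.
  split=> //; apply/eqP/setP => i; rewrite !inE; apply/imsetP/idP => [[w]|nii0].
    rewrite !inE => /andP[nwx wR] ->; apply: contra nwx => /eqP.
    by rewrite i0x => /injc ->.
  have /imsetP[w wR iw] : i \in c @: R by rewrite full inE.
  exists w => //; rewrite !inE wR andbT; apply: contra nii0 => /eqP wx.
  by rewrite iw wx i0x.
have [->|[x]] := set_0Vmem [set x in R | c @: (R :\ x) == [set~ i0]].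
  by rewrite cards0.
rewrite !inE => /andP[xR /eqP cx].
have injc : {in R :\ x &, injective c}.
  apply/imset_injP; rewrite cx cardsC1; apply/eqP.
  by rewrite -cR (cardsD1 x R) xR.
have ncx : c x != i0.
  apply: contra nfull => /eqP cxi0; apply/eqP/setP => i; rewrite inE.
  have [->|nii0] := eqVneq i i0; first by rewrite -cxi0 imset_f.
  have : i \in c @: (R :\ x) by rewrite cx !inE.
  by apply: fintype.subsetP; rewrite imsetS// finset.subsetDl.
have /imsetP[x' x'R cxx'] : c x \in c @: (R :\ x) by rewrite cx !inE.
move: (x'R); rewrite !inE => /andP[nx'x x'R'].
rewrite (_ : [set _ in R | _] = [set x; x']) ?cards2 1?eq_sym ?nx'x//.
apply/setP => z; rewrite !inE; apply/andP/orP => [[zR /eqP cz]|].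
  apply/orP; apply: contraT; rewrite negb_or => /andP[nzx nzx'].
  have czi0 : c z != i0.
    have : c z \in c @: (R :\ x) by rewrite imset_f// !inE nzx.
    by rewrite cx !inE.
  have /imsetP[w] : c z \in c @: (R :\ z) by rewrite cz !inE.
  rewrite !inE => /andP[nwz wR] czw.
  have [wx|nwx] := eqVneq w x.
    move: czw; rewrite wx cxx' => /injc zx'.
    by move: nzx'; rewrite zx' ?eqxx// !inE nzx.
  by move: nwz; rewrite -(injc _ _ _ _ czw) ?eqxx// !inE ?nzx ?nwx.
case=> /eqP ->; first by split=> //; apply/eqP.
split=> //; rewrite -cx; apply/eqP/setP => i.
apply/imsetP/imsetP => -[w]; rewrite !inE => /andP[nw wR] ->.
  have [->|nwx] := eqVneq w x; first by exists x'.
  by exists w; rewrite // !inE nwx.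
have [->|nwx] := eqVneq w x'; last by exists w; rewrite // !inE nwx.
by exists x; rewrite // !inE eq_sym nx'x.
Qed.

Let S0 := e @: [set~ i0].

(** Each [e l] with [l != i0] is in [S0] and least for the order [l], so only the order [i0] can
    witness dominance at a [y] outside [S0]. *)
Lemma dominant_outer x : x \notin S0 ->
  dominant (x |: S0) = [forall y, (y \notin S0) ==> (r i0 y <= r i0 x)].
Proof.
move=> xS0; apply/dominantP/forall_inP => [dx y yS0|h y].
  have [l hl] := dx y; have [<-|nl] := eqVneq l i0.
    by apply: hl; rewrite !inE eqxx.
  case/negP: yS0; suff -> : y = e l by rewrite imset_f// !inE.
  apply: (@rinj l); apply/eqP; rewrite eqn_leq e_min andbT.
  by apply: hl; rewrite !inE imset_f ?orbT// !inE.
have [/imsetP[l _ ->]|yS0] := boolP (y \in S0).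
  by exists l => s _; exact: e_min.
exists i0 => s; rewrite !inE => /orP[/eqP ->|]; first exact: h.
case/imsetP => l; rewrite !inE => nl ->.
have [/codomP[k yk]|yc] := boolP (y \in codom e); last exact: e_max.
have [ki0|nk] := eqVneq k i0; first by rewrite yk ki0 e_min.
by case/negP: yS0; rewrite yk imset_f// !inE.
Qed.

(** The only choice is the largest element outside [S0] for the order [i0]. *)
Lemma outer_room : exists x,
  [set x | x \notin S0 & dominant (x |: S0)] = [set x].
Proof.
have ei0 : e i0 \notin S0.
  by rewrite mem_imset ?inE ?eqxx//; exact: can_inj ce.
case: (@arg_maxnP _ (e i0) [pred y | y \notin S0] (r i0) ei0) => x xS0 mx.
exists x; apply/setP => y; rewrite !inE.
apply/andP/eqP => [[yS0]|->].
  rewrite dominant_outer// => /forall_inP h.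
  by apply: (@rinj i0); apply/eqP; rewrite eqn_leq h// andbT; exact: mx.
by split=> //; rewrite dominant_outer//; apply/forall_inP => z /mx.
Qed.

(** Every element of [S] is the minimum of some order, and there is one more order than elements, so
    exactly two orders [i] and [j] share their minimum. A new element must become the minimum of one
    of these two and leave all other minima in place; each case has exactly one solution. *)
Lemma inner_rooms (S : {set Y}) : door S -> S != S0 ->
  exists x x', x != x' /\
    [set x | x \notin S & dominant (x |: S)] = [set x; x'].
Proof.
case/and3P => dS /eqP cS /eqP cardS SS0.
(* Without a non-slack, [S] would be [e @: (c @: S) = S0]. The element [z] serves to show that [e a]
   lies in [M a]. *)
have [z zS zne] : exists2 z, z \in S & z \notin codom e.
  apply/exists_inP; rewrite -[X in is_true X]negbK negb_exists.
  apply: contra SS0 => /forallP h; have {}h : {in S, forall s, s = e (c s)}.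
    move=> s sS; have := h s; rewrite sS negbK => /codomP[k ->].
    by rewrite ce.
  by rewrite /S0 -cS -imset_comp; apply/eqP/setP => s; apply/idP/imsetP
    => [sS|[t tS ->]]; [exists s => //; exact: h|rewrite /= -h].
pose mu i := [arg min_(s < z in S) r i s].
have muS i : mu i \in S by rewrite /mu; case: arg_minnP.
have mule i s : s \in S -> r i (mu i) <= r i s.
  by rewrite /mu; case: arg_minnP => // t _ h /h.
have mu_eq i s : s \in S -> {in S, forall t, r i s <= r i t} -> mu i = s.
  by move=> sS h; apply: (@rinj i); apply/eqP; rewrite eqn_leq mule ?h.
have muT : mu @: [set: I] = S.
  apply/setP => s; apply/imsetP/idP => [[i _ ->//]|sS].
  have /dominantP/(_ s)[i h] := dS.
  by exists i; rewrite ?inE// (mu_eq i s).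
have I0 : 0 < #|I| by apply/card_gt0P; exists i0.
have [i [j [nij muij]]] : exists i j, i != j /\ mu i = mu j.
  have : ~~ injectiveb mu.
    apply/negP => /injectiveP injmu.
    have := card_imset [set: I] injmu; rewrite muT cardsT cardS.
    by move/eqP; rewrite -{2}(prednK I0) -[_ == _]/(_ == _)%N ltn_eqF.
  move/injectivePn => [i [j nij muij]]; by exists i, j.
have muC a b : a != b -> mu a = mu b -> {in [set~ a] &, injective mu}.
  move=> nab ab; apply/imset_injP; rewrite cardsC1 -cardS -muT.
  apply/eqP; congr #|pred_of_set _|; apply/setP => s.
  apply/imsetP/imsetP => -[k kI ->]; first by exists k.
  have [->|nka] := eqVneq k a; last by exists k; rewrite ?inE.
  by exists b => //; rewrite !inE eq_sym.
(* Inserting an element of [M a] keeps the minimum of every order but [a]; for [a] among [i] and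
   [j], the largest one for the order [a] is the one to insert. *)
pose M a := [set y | [forall (l | l != a), r l (mu l) < r l y]].
have MP a y : reflect (forall l, l != a -> r l (mu l) < r l y) (y \in M a).
  by rewrite inE; exact: forall_inP.
have notMM x : ~ (x \in M i /\ x \in M j).
  case=> /MP xi /MP xj.
  have /dominantP/(_ x)[l h] := dS.
  have [li|/xi] := eqVneq l i; last by rewrite ltnNge h.
  by have := xj l; rewrite li nij => /(_ isT); rewrite -li ltnNge h.
have eM a b : a != b -> mu a = mu b -> e a \in M a.
  move=> nab ab; apply/MP => l nla.
  have h : r l z <= r l (e a) by apply: e_max => //; rewrite eq_sym.
  rewrite ltn_neqAle (leq_trans (mule _ _ zS) h) andbT.
  apply/eqP => /rinj mula.
  have zea : z = e a.
    apply: (@rinj l); apply/eqP; rewrite eqn_leq h/= -mula; exact: mule.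
  by move: zne; rewrite zea codom_f.
have MS a b x : a != b -> mu a = mu b -> x \in M a -> x \notin S.
  move=> nab ab /MP xM; apply/negP => xS.
  have : x \in mu @: [set: I] by rewrite muT.
  case/imsetP => k _ xk; have [ka|/xM] := eqVneq k a.
    by have := xM b; rewrite eq_sym nab => /(_ isT); rewrite xk ka ab ltnn.
  by rewrite xk ltnn.
have maxM a b : a != b -> mu a = mu b ->
    exists2 x, x \in M a & {in M a, forall y, r a y <= r a x}.
  move=> nab ab; have eaM := eM a b nab ab.
  by case: (@arg_maxnP _ (e a) [in M a] (r a) eaM) => x xM h; exists x.
have domM a b x : a != b -> mu a = mu b -> x \in M a ->
    {in M a, forall y, r a y <= r a x} -> dominant (x |: S).
  move=> nab ab xM mx; apply/dominantP => y.
  have [yM|] := boolP (y \in M a).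
    exists a => s; rewrite !inE => /orP[/eqP ->|sS]; first exact: mx.
    have /dominantP/(_ y)[l h] := dS.
    have [la|nla] := eqVneq l a; first by rewrite -la h.
    by move/MP: yM => /(_ _ nla); rewrite ltnNge h.
  rewrite inE => /forallPn[l]; rewrite negb_imply -leqNgt => /andP[nla h].
  exists l => s; rewrite !inE => /orP[/eqP ->|sS].
    by move/MP: xM => /(_ _ nla) /ltnW; exact: leq_trans.
  by rewrite (leq_trans h)// mule.
have [x xM mx] := maxM i j nij muij.
have nji : j != i by rewrite eq_sym.
have [x' x'M mx'] := maxM j i nji (esym muij).
exists x, x'; split.
  by apply/eqP => xx'; apply: (notMM x); rewrite {2}xx'.
apply/setP => w; rewrite !inE; apply/andP/orP => [[wS dw]|]; last first.
  case=> /eqP ->; split.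
  - exact: MS nij muij xM.
  - exact: domM nij muij xM mx.
  - exact: MS nji (esym muij) x'M.
  - exact: domM nji (esym muij) x'M mx'.
(* The orders whose minimum survives the insertion of [w]. All elements of [S] must remain minima,
   so at most one order is missing; dominance at [w] itself shows that one is. *)
pose A := [set l | r l (mu l) < r l w].
have muA : mu @: A = S.
  apply/setP => s; apply/imsetP/idP => [[l _ ->//]|sS].
  have /dominantP/(_ s)[l h] := dw.
  have ls : mu l = s.
    by apply: mu_eq => // t tS; apply: h; rewrite !inE tS orbT.
  exists l => //; rewrite inE ltn_neqAle ls h ?inE ?eqxx// andbT.
  by apply: contra wS => /eqP/rinj <-.
have /dominantP/(_ w)[l hl] := dw.
have lA : l \notin A by rewrite inE -leqNgt hl// !inE muS orbT.
have AE : A = [set~ l].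
  apply/eqP; rewrite eqEcard; apply/andP; split.
    apply/fintype.subsetP => k; rewrite !inE => kA.
    by apply: contra lA => /eqP <-; rewrite inE.
  by rewrite cardsC1 -cardS -muA leq_imset_card.
have wM : w \in M l.
  apply/MP => k nkl; have : k \in A by rewrite AE !inE.
  by rewrite inE.
(* [mu l] is also the minimum of an order other than [l], and only [i] and [j] share one. *)
have lij : (l == i) || (l == j).
  apply: contraT; rewrite negb_or => /andP[nli nlj].
  have : mu l \in mu @: A by rewrite muA.
  case/imsetP => k; rewrite AE !inE => nkl mulk.
  have [ki|nki] := eqVneq k i.
    have := muC _ _ nji (esym muij) l k; rewrite !inE nlj ki nij -ki => h.
    by move: nkl; rewrite (h isT isT mulk) eqxx.
  have := muC _ _ nij muij l k; rewrite !inE nli nki => h.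
  by move: nkl; rewrite (h isT isT mulk) eqxx.
have mw : {in M l, forall y, r l y <= r l w}.
  move=> y /MP yM; have /dominantP/(_ y)[k hk] := dw.
  have [kl|/yM] := eqVneq k l; first by rewrite -kl hk// !inE eqxx.
  by rewrite ltnNge hk// !inE muS orbT.
case/orP: lij => /eqP li; rewrite li in wM mw; [left|right]; apply/eqP.
  by apply: (@rinj i); apply/eqP; rewrite eqn_leq mx// mw.
by apply: (@rinj j); apply/eqP; rewrite eqn_leq mx'// mw.
Qed.

Lemma odd_rooms_of_door (S : {set Y}) : door S ->
  odd #|[set x | x \notin S & dominant (x |: S)]| = (S == S0).
Proof.
move=> dS; have [->|SS0] := eqVneq S S0.
  by have [x ->] := outer_room; rewrite cards1.
by have [x [x' [nxx' ->]]] := inner_rooms dS SS0; rewrite cards2 nxx'.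
Qed.

Lemma door_outer : door S0.
Proof.
have [x xE] := outer_room.
have : x \in [set x | x \notin S0 & dominant (x |: S0)] by rewrite xE inE.
rewrite inE => /andP[_ /(sub_dominant (finset.subsetUr [set x] S0)) dS0].
rewrite /door dS0/=.
rewrite card_imset ?cardsC1 ?eqxx ?andbT; last exact: can_inj ce.
by rewrite /S0 -imset_comp (eq_imset (g := id) _ ce) imset_id.
Qed.

(** Double counting through the bijection between pairs [(S, x)] and [(R, x)] with [R = x |: S]. *)
Lemma door_room_incidence :
  \sum_(S | door S) #|[set x | x \notin S & dominant (x |: S)]| =
  \sum_(R | room R) #|[set x in R | c @: (R :\ x) == [set~ i0]]|.
Proof.
have I0 : 0 < #|I| by apply/card_gt0P; exists i0.
under eq_bigr do rewrite -sum1_card big_mkcond.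
under [RHS]eq_bigr do rewrite -sum1_card big_mkcond.
rewrite exchange_big [RHS]exchange_big; apply: eq_bigr => x _ /=.
rewrite -big_mkcondr -[RHS]big_mkcondr/=.
rewrite (reindex_onto (fun R => R :\ x) (fun S => x |: S)) /=; last first.
  move=> S /andP[_]; rewrite inE => /andP[xS _].
  by rewrite setU1K.
apply: eq_bigl => R; rewrite !inE eqxx/=.
have [xR|xR] := boolP (x \in R); last first.
  rewrite !(andbF, andFb)/=; apply: contraNF xR => /andP[_ /eqP <-].
  by rewrite !inE eqxx.
rewrite finset.setD1K// eqxx andbT/= /door /room.
have -> : (#|R :\ x| == #|I|.-1) = (#|R| == #|I|).
  by rewrite (cardsD1 x R) xR/= -[in RHS](prednK I0) eqSS.
case: (boolP (dominant R)) => dR; rewrite ?andbF//= andbT.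
by rewrite (sub_dominant (finset.subsetDl R [set x]) dR)/= andbC.
Qed.

Lemma scarf_parity :
  exists R : {set Y}, dominant R /\ c @: R = [set: I].
Proof.
suff /existsP[R /andP[/andP[dR _] /eqP cR]] :
  [exists R, room R && (c @: R == [set: I])] by exists R.
apply: contraT; rewrite negb_exists => /forallP h.
have := congr1 odd door_room_incidence; rewrite !odd_sum.
rewrite (bigD1 S0) ?door_outer//= big1 => [|S /andP[dS SS0]]; last first.
  by rewrite odd_rooms_of_door// (negbTE SS0).
rewrite odd_rooms_of_door ?door_outer// eqxx big1 => // R rR.
case/andP: (rR) => _ /eqP cR; rewrite odd_doors_of_room//.
by apply/negbTE; have := h R; rewrite rR.
Qed.

End scarf_parity.

(** * Scarf's lemma for orders with ties *)

Section scarf.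
Variables (X I : finType) (f : I -> X -> nat) (c : X -> I) (i0 : I).

(* Ties of [f i] are broken by the enumeration rank. *)
Let rank (i : I) (y : X + I) : nat :=
  match y with
  | inl x => (f i x * #|X| + enum_rank x).+1
  | inr j => if j == i then 0
             else ((\max_x f i x).+1 * #|X|).+1 + enum_rank j
  end.

(** The bound lies just below the rank of every slack of another colour; the successor in the rank
    of [inl x] reserves [0] for the slack [inr i]. *)
Let rank_inl i x : rank i (inl x) <= (\max_x f i x).+1 * #|X|.
Proof.
have lex : enum_rank x < #|X| := ltn_ord _.
have lef : f i x <= \max_x f i x by exact: leq_bigmax.
by rewrite /rank mulSn addnC -addSn leq_add// leq_mul.
Qed.

Let rank_inj i : injective (rank i).
Proof.
move=> [x|j] [y|k].
- move=> /= [] h; have cX : 0 < #|X| by apply/card_gt0P; exists x.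
  congr inl; apply: enum_rank_inj; apply: val_inj.
  have := congr1 (modn^~ #|X|) h.
  by rewrite !modnMDl !modn_small.
- have := rank_inl i x; rewrite /rank; case: eqP => [|_]; first by [].
  by move=> + h; rewrite h; lia.
- have := rank_inl i y; rewrite /rank; case: eqP => [|_]; first by [].
  by move=> + h; rewrite -h; lia.
rewrite /rank; case: (eqVneq j i) => [->|nj]; case: (eqVneq k i) => [->|nk]//.
by move=> /addnI/val_inj/enum_rank_inj ->.
Qed.

(** [D] holds the non-slacks of the set given by [scarf_parity], and [J] the colours whose slack it
    lacks. Those colours must come from non-slacks, and an order whose slack is in the set cannot
    witness dominance at a non-slack, since that slack has rank [0]. *)
Lemma scarf_coloring : exists (D : {set X}) (J : {set I}),
  (forall x, exists2 i, i \in J & {in D, forall d, f i x <= f i d}) /\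
  {in J, forall i, exists2 d, d \in D & c d = i}.
Proof.
pose c' (y : X + I) := match y with inl x => c x | inr i => i end.
have := @scarf_parity (X + I)%type I rank inr c' rank_inj.
case/(_ _ _ _ i0) => //.
- by move=> i y; rewrite /= eqxx.
- move=> i j [x nj _|k _ /negP[]]; last by rewrite codom_f.
  by have := rank_inl i x; rewrite /= (negbTE nj); lia.
move=> S [/dominantP dS cS].
exists [set x | inl x \in S], [set i | inr i \notin S]; split=> [x|i].
  have [i hi] := dS (inl x); exists i.
    by rewrite inE; apply/negP => /hi; rewrite /= eqxx.
  move=> d; rewrite inE => /hi /=; rewrite ltnS => h.
  have cX : 0 < #|X| by apply/card_gt0P; exists x.
  (* Dividing the ranks by [#|X|] discards the tie-breaker. *)
  by have := leq_div2r #|X| h; rewrite !divnMDl// !divn_small// !addn0.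
rewrite inE => iS; have : i \in c' @: S by rewrite cS inE.
case/imsetP => -[x xS /= ->|j jS /= ij]; last by rewrite ij jS in iS.
by exists x; rewrite ?inE.
Qed.

End scarf.

(** * Scarf's lemma on the grid points of the simplex *)

Section grid.
Variables (I : finType) (k : nat).

Definition grid := {x : {ffun I -> 'I_k.+1} | \sum_i x i == k}.

Definition gridc (d : grid) (i : I) : nat := val d i.

Implicit Types d : grid.

Lemma grid_sum d : \sum_i gridc d i = k.
Proof. exact/eqP/(valP d). Qed.

Lemma grid_of (x : I -> nat) : \sum_i x i = k ->
  exists d, forall i, gridc d i = x i.
Proof.
move=> sx; have xk i : x i < k.+1.
  by rewrite ltnS -sx (bigD1 i)//= leq_addr.
have sx' : \sum_i [ffun i => Ordinal (xk i)] i == k.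
  by apply/eqP; rewrite -[RHS]sx; apply: eq_bigr => i _; rewrite ffunE.
by exists (Sub [ffun i => Ordinal (xk i)] sx') => i; rewrite /gridc SubK ffunE.
Qed.

(** Dominance forces the minima [a i] to be large: their sum over [J] exceeds [k - #|I|]. As
    coordinates sum to [k], every point of [D] is within [#|I|] of [a] on [J] and below [#|I|] off
    [J], so any two points of [D] are close. *)
Lemma scarf_grid (c : grid -> I) (i0 : I) :
  exists d0 : grid, forall i, gridc d0 i < #|I| \/
    exists d : grid, c d = i /\ forall j,
      (gridc d j < gridc d0 j + #|I|) && (gridc d0 j < gridc d j + #|I|).
Proof.
have [D [J [dom lab]]] := scarf_coloring (fun i d => gridc d i) c i0.
(* Dominance at some grid point shows that [J], hence [D], is nonempty. *)
have [g0 _] : exists d : grid, forall i, gridc d i = (if i == i0 then k else 0).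
  by apply: grid_of; rewrite -big_mkcond big_pred1_eq.
have [j0 j0J _] := dom g0.
have [d0 d0D _] := lab j0 j0J.
pose a i : nat := gridc [arg min_(d < d0 in D) gridc d i] i.
have ale i d : d \in D -> a i <= gridc d i.
  by rewrite /a; case: arg_minnP => // t _ h /h.
have aD i : exists2 d, d \in D & a i = gridc d i.
  by rewrite /a; case: arg_minnP => // t tD _; exists t.
have sumJ : k < \sum_(i in J) (a i).+1.
  rewrite ltnNge; apply/negP => le.
  (* This point exceeds [a] in every coordinate of [J], the rest of [k] being put on [j0]; dominance
     forbids it. *)
  pose x i := if i \in J then
    (a i).+1 + (if i == j0 then k - \sum_(i in J) (a i).+1 else 0) else 0.
  have [d dx] : exists d : grid, forall i, gridc d i = x i.
    apply: grid_of; rewrite /x -big_mkcond/= big_split/= -big_mkcondr/=.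
    rewrite [X in _ + X](big_pred1 j0) ?subnKC// => i /=.
    by case: eqP => [->|]; rewrite ?j0J ?andbF.
  have [i iJ h] := dom d; have [d' d'D ad'] := aD i.
  by have := h d' d'D; rewrite dx /x iJ -ad'; lia.
have cJ : #|J| <= #|I| by exact: max_card.
have sumJ' : k < \sum_(i in J) a i + #|I|.
  apply: leq_trans sumJ _; under eq_bigr do rewrite -addn1.
  by rewrite big_split/= sum1_card leq_add2l.
have out d i : d \in D -> i \notin J -> gridc d i < #|I|.
  move=> dD iJ; rewrite -(ltn_add2l (\sum_(j in J) a j)).
  apply: leq_ltn_trans sumJ'; rewrite -[X in _ <= X](grid_sum d).
  rewrite [X in _ <= X](bigID (fun j => j \in J))/= leq_add//.
    by apply: leq_sum => j _; exact: ale.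
  by rewrite (bigD1 i)//= leq_addr.
have inn d i : d \in D -> i \in J -> gridc d i < a i + #|I|.
  move=> dD iJ; rewrite -(ltn_add2l (\sum_(j in J | j != i) a j)).
  move: sumJ'; rewrite addnA (bigD1 i iJ)/= [a i + _]addnC.
  apply: leq_ltn_trans; rewrite -[X in _ <= X](grid_sum d).
  rewrite [X in _ <= X](bigID (fun j => j \in J))/=.
  rewrite [X in _ <= X + _](bigD1 i)//=.
  rewrite [X in _ <= X + _]addnC -addnA leq_add//; last exact: leq_addr.
  by apply: leq_sum => j _; exact: ale.
exists d0 => i; have [iJ|iJ] := boolP (i \in J); last by left; exact: out.
right; have [d dD cd] := lab i iJ; exists d; split=> // j.
have [jJ|jJ] := boolP (j \in J).
  have := ale j d dD; have := ale j d0 d0D.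
  by have := inn d j dD jJ; have := inn d0 j d0D jJ; lia.
by have := out d j dD jJ; have := out d0 j d0D jJ; lia.
Qed.

End grid.

(** * Brouwer's theorem on the simplex *)

Local Open Scope classical_set_scope.
Local Open Scope ring_scope.

Lemma nbhs_dist_lt (R : realType) (V : normedModType R) (x : V) (d : R) :
  0 < d -> nbhs x [set y | `|x - y| < d].
Proof. by move=> d0; apply/nbhs_normP; exists d. Qed.

Lemma within_continuous_normP (R : realType) (U V : normedModType R)
    (A : set U) (f : U -> V) :
  {within A, continuous f} <->
  forall x, A x -> forall e : R, 0 < e -> exists2 d : R, 0 < d &
    forall y, A y -> `|x - y| < d -> `|f x - f y| < e.
Proof.
rewrite subspace_continuousP; split=> fc x Ax.
  move=> e e0; have /cvgrPdist_lt/(_ e e0) := fc x Ax.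
  by move=> /nbhs_normP[d /= d0 h]; exists d => // y Ay xy; exact: h.
apply/cvgrPdist_lt => e e0; have [d d0 h] := fc x Ax e e0.
by apply/nbhs_normP; exists d => //= y xy Ay; exact: h.
Qed.

Lemma rV_norm_ltP (R : realType) (n : nat) (x : 'rV[R]_n) (e : R) : 0 < e ->
  reflect (forall j, `|x ord0 j| < e) (`|x| < e).
Proof.
move=> e0; rewrite [ltLHS]mx_normrE.
apply: (iffP idP) => [/bigmax_ltP[_ h] j|h]; first exact: (h (ord0, j)).
by apply/bigmax_ltP; split=> // -[i j] _; rewrite ord1.
Qed.

Section simplex.
Variables (R : realType) (n : nat).
Local Notation vec := 'rV[R]_n.+1.

Definition simplex : set vec :=
  [set x | (forall i, 0 <= x ord0 i) /\ \sum_i x ord0 i = 1].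

Lemma simplex_compact : compact simplex.
Proof.
apply: (@subclosed_compact _ simplex
    [set v : vec | forall i, [set` `[0 : R, 1]%R] (v ord0 i)]).
- have -> : simplex =
      (\bigcap_(i in setT) [set x : vec | 0 <= x ord0 i]) `&`
      [set x : vec | \sum_i x ord0 i = 1].
    apply/seteqP; split=> x [h1 h2]; split=> //; first by move=> i _; exact: h1.
    by move=> i; exact: h1.
  apply: closedI.
    apply: closed_bigI => i _; apply: (@preimage_closed _ _
      (fun x : vec => x ord0 i) [set t | 0 <= t]); last exact: closed_ge.
    by move=> x _; exact: coord_continuous.
  apply: (@preimage_closed _ _ (fun x : vec => \sum_i x ord0 i)
    [set t | t = 1]); last exact: closed_eq.
  move=> x _; apply: (cvg_big add_continuous); first exact: nbhs_filter.
  by move=> i _; exact: coord_continuous.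
- apply: (@rV_compact R _ (fun=> `[0, 1]%classic)) => i.
  exact: segment_compact.
- move=> x [x0 x1] i /=; rewrite in_itv/= x0/= -x1 (bigD1 i)//=.
  by rewrite lerDl sumr_ge0.
Qed.

Lemma scarf_simplex (c : vec -> 'I_n.+1) (d : R) : 0 < d ->
  exists2 z, simplex z & forall i, z ord0 i < d \/
    exists x, [/\ simplex x, c x = i & forall j, `|x ord0 j - z ord0 j| < d].
Proof.
(* Makes [n.+1] grid steps of length [1/k] shorter than [d]; [n.+1] is the [#|I|] of
   [scarf_grid]. *)
move=> d0; pose k := (Num.truncn (n.+1%:R / d)).+1.
have k0 : 0 < k%:R :> R by rewrite ltr0n.
have nkd : n.+1%:R / k%:R < d.
  by rewrite ltr_pdivrMr// mulrC -ltr_pdivrMr// /k truncnS_gt.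
pose pt (g : grid 'I_n.+1 k) : vec := \row_i ((gridc g i)%:R / k%:R).
have ptS g : simplex (pt g).
  split=> [i|]; first by rewrite mxE divr_ge0.
  under eq_bigr do rewrite mxE; rewrite -mulr_suml -natr_sum grid_sum.
  by rewrite divff// gt_eqF.
have [g0 hg0] := scarf_grid (c \o pt) ord0.
exists (pt g0) => // i; move: (hg0 i); rewrite card_ord.
move=> [h|[g [cg h]]].
  left; apply: le_lt_trans nkd; rewrite mxE ler_pM2r ?invr_gt0// ler_nat.
  exact: ltnW.
right; exists (pt g); split=> // j; apply: le_lt_trans nkd.
rewrite !mxE -mulrBl normrM (gtr0_norm (x := k%:R^-1)) ?invr_gt0//.
rewrite ler_pM2r ?invr_gt0// ler_distlC.
have /andP[/ltnW h1 /ltnW h2] := h j.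
by rewrite lerBlDr -!natrD !ler_nat h1 h2.
Qed.

(** Points are coloured by a coordinate that [f] does not decrease. If [f] fixes no point, then near
    each [z] some coordinate is decreased by [f] and bounded away from [0], so points near [z] fail
    the conclusion of [scarf_simplex] for small [d]. Compactness makes [d] uniform. *)
Lemma brouwer_simplex (f : vec -> vec) :
  set_fun simplex simplex f -> {within simplex, continuous f} ->
  exists2 x, simplex x & f x = x.
Proof.
move=> fS /within_continuous_normP fc; apply: contrapT => nofix.
(* On the simplex the default [ord0] is not reached: [x] and [f x] have the same coordinate sum. *)
pose c (x : vec) : 'I_n.+1 := odflt ord0 [pick i | x ord0 i <= f x ord0 i].
have le_sum_eq (x : vec) : simplex x -> (forall i, x ord0 i <= f x ord0 i) ->
    f x = x.
  move=> Sx le; apply/rowP => i; apply/eqP; rewrite eq_sym; apply/eqP.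
  have /eqP : \sum_i (f x ord0 i - x ord0 i) = 0.
    by rewrite sumrB (fS x Sx).2 Sx.2 subrr.
  rewrite psumr_eq0 => [/allP/(_ i)|j _]; last by rewrite subr_ge0.
  by rewrite mem_index_enum subr_eq0 => /(_ isT)/eqP.
have cP x : simplex x -> x ord0 (c x) <= f x ord0 (c x).
  move=> Sx; rewrite /c; case: pickP => //= h; exfalso.
  have : \sum_i f x ord0 i < \sum_i x ord0 i.
    apply: ltr_sum => [|i _]; last by rewrite ltNge h.
    by apply/hasP; exists ord0; rewrite ?mem_index_enum.
  by rewrite (fS x Sx).2 Sx.2 ltxx.
pose P (d : R) (z : vec) := ~ forall i, z ord0 i < d \/
  exists x, [/\ simplex x, c x = i & forall j, `|x ord0 j - z ord0 j| < d].
have : \forall d \near 0^'+, simplex `<=` P d.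
  have /compact_near_coveringP := simplex_compact; apply => z Sz.
  have [i fzi] : exists i, f z ord0 i < z ord0 i.
    apply: contrapT => h; apply: nofix; exists z => //.
    apply: le_sum_eq => // i.
    by rewrite leNgt; apply/negP => fzi; apply: h; exists i.
  pose eta := z ord0 i - f z ord0 i.
  have eta0 : 0 < eta by rewrite subr_gt0.
  have [r0 r00 hr0] := fc z Sz (eta / 3) ltac:(lra).
  (* Passing from [z] to [x] changes the coordinate [i] and its image by less than [eta / 3] each,
     so [f] still decreases it at [x]. Half of [r] is spent from [z] to [z'], half from [z'] to
     [x]. *)
  pose r := Num.min r0 (eta / 3).
  have r_gt0 : 0 < r by rewrite lt_min r00; lra.
  have r20 : 0 < r / 2 by lra.
  have e30 : 0 < eta / 3 by lra.
  have rr0 : r <= r0 by rewrite ge_min lexx.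
  have re : r <= eta / 3 by rewrite ge_min lexx orbT.
  have zr : nbhs z [set z' | `|z - z'| < r / 2].
    by apply: nbhs_dist_lt; lra.
  exists ([set z' | `|z - z'| < r / 2], [set d | d < r / 2]).
    split; first exact: zr.
    by apply: nbhs_right_lt; lra.
  move=> [z' d] /= [zz' dr]; move=> /(_ i) h.
  have zz'i : `|z ord0 i - z' ord0 i| < r / 2.
    by have /(rV_norm_ltP _ r20)/(_ i) := zz'; rewrite !mxE.
  have fz0 : 0 <= f z ord0 i by exact: (fS z Sz).1.
  case: h => [|[x [Sx cx xz']]].
    by move: zz'i; rewrite ltr_distlC /eta in re *; lra.
  have zx : `|z - x| < r.
    apply/rV_norm_ltP => // j; rewrite !mxE.
    have := xz' j; have /(rV_norm_ltP _ r20)/(_ j) := zz'.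
    by rewrite !mxE !ltr_distlC; lra.
  have /(rV_norm_ltP _ r_gt0)/(_ i) := zx.
  have /(rV_norm_ltP _ e30)/(_ i) := hr0 x Sx (lt_le_trans zx rr0).
  have := cP x Sx.
  by rewrite cx !mxE !ltr_distlC /eta in re *; lra.
move=> [e /= e0 he].
have e20 : 0 < e / 2 by lra.
have [z Sz hz] := scarf_simplex c e20.
apply: (he (e / 2) _ e20 z Sz) => //=.
by rewrite sub0r normrN gtr0_norm//; lra.
Qed.

End simplex.

(** * Schauder's theorem *)

Section convex_combination.
Variables (R : realType) (X : normedModType R) (K : set X).
Hypothesis Kconv : convex_set (K : set (convex_lmodType X)).

Lemma convex_set_segment (x y : X) (t : R) : K x -> K y -> 0 <= t -> t <= 1 ->
  K (t *: x + (1 - t) *: y).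
Proof.
move=> Kx Ky t0 t1.
exact/set_mem/(Kconv (Itv01 t0 t1) (mem_set Kx) (mem_set Ky)).
Qed.

(* Weights need not sum to 1, so that the induction does not renormalise. *)
Lemma convex_set_weighted_mean (n : nat) (w : 'I_n -> R) (y : 'I_n -> X) :
  (forall i, 0 <= w i) -> 0 < \sum_i w i -> (forall i, K (y i)) ->
  K ((\sum_i w i)^-1 *: \sum_i w i *: y i).
Proof.
elim: n w y => [|n IH] w y w0; first by rewrite big_ord0 ltxx.
rewrite !big_ord_recr/=; set W := \sum_(i < n) _; set v := \sum_(i < n) _.
move=> W0 Ky.
have [W_eq0|W_neq0] := eqVneq W 0.
  have wi i : w (widen_ord (leqnSn n) i) = 0.
    have /eqP := W_eq0; rewrite psumr_eq0// => /allP/(_ i).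
    by rewrite mem_index_enum => /(_ isT)/eqP.
  have -> : v = 0 by apply: big1 => i _; rewrite wi scale0r.
  move: W0; rewrite W_eq0 !add0r => W0.
  by rewrite scalerA mulVf ?gt_eqF// scale1r.
have Wgt0 : 0 < W by rewrite lt_neqAle eq_sym W_neq0 sumr_ge0.
have Kv : K (W^-1 *: v) by apply: IH.
set a := w ord_max; rewrite -/a in W0 *.
have a0 : 0 <= a by exact: w0.
have := convex_set_segment Kv (Ky ord_max) (t := W / (W + a)) _ _.
rewrite (_ : _ + _ = (W + a)^-1 *: (v + a *: y ord_max)).
  apply; first by rewrite divr_ge0// ltW.
  by rewrite ler_pdivrMr// mul1r lerDl.
rewrite scalerA scalerDr scalerA; congr (_ *: _ + _ *: _).
  by rewrite mulrAC divff// mul1r.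
by field; rewrite gt_eqF.
Qed.

Lemma convex_set_combination (n : nat) (x : 'rV[R]_n.+1) (y : 'I_n.+1 -> X) :
  simplex x -> (forall i, K (y i)) -> K (\sum_i x ord0 i *: y i).
Proof.
move=> [x0 x1] Ky; have := @convex_set_weighted_mean _ (x ord0) y x0.
by rewrite x1 invr1 scale1r; apply.
Qed.

End convex_combination.

Section schauder.
Variables (R : realType) (X : normedModType R).

Lemma compact_net (C : set X) (e : R) : compact C -> C !=set0 -> 0 < e ->
  exists n (y : 'I_n.+1 -> X), (forall i, C (y i)) /\
    forall v, C v -> exists i, `|v - y i| < e.
Proof.
move=> + [c0 Cc0] e0; rewrite compact_cover => /(_ X C (fun y => ball y e)).
case=> [y _|v Cv|D DC Dcov]; first exact: ball_open.
  by exists v => //; exact: ballxx.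
pose s := enum_fset D.
have inD i : (i < size s)%N -> nth 0 s i \in D by move=> ?; exact: mem_nth.
have s0 : (0 < size s)%N.
  have [y /= yD _] := Dcov c0 Cc0.
  by rewrite (leq_ltn_trans (leq0n (index y s)))// index_mem.
exists (size s).-1, (fun i => nth 0 s i); split=> [i|v Cv].
  by apply/set_mem/DC/inD; rewrite -[ltnRHS](prednK s0).
have [y /= yD] := Dcov v Cv; rewrite -ball_normE/= => yv.
have ys : (index y s < (size s).-1.+1)%N by rewrite (prednK s0) index_mem.
by exists (Ordinal ys) => /=; rewrite nth_index// distrC.
Qed.

Variables (K C : set X) (G : X -> X).
Hypotheses (Kconv : convex_set (K : set (convex_lmodType X))) (K0 : K !=set0).
Hypotheses (Ccompact : compact C) (CK : C `<=` K).
Hypotheses (GC : set_fun K C G) (Gcont : {within K, continuous G}).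

(** The Schauder projection: [phi i] weights the points of a finite [e]-net of [C], and [f] is the
    map that [G] induces on the weights. At its fixed point, [p x] is a mean of those [y i] that lie
    within [e] of [G (p x)]. *)
Lemma schauder_approx (e : R) : 0 < e -> exists2 x, K x & `|x - G x| <= e.
Proof.
move=> e0; have C0 : C !=set0 by have [x Kx] := K0; exists (G x); exact: GC.
have [n [y [Cy net]]] := compact_net Ccompact C0 e0.
pose phi i (v : X) : R := Num.max (e - `|v - y i|) 0.
have phi_ge0 i v : 0 <= phi i v by rewrite le_max lexx orbT.
pose Phi v := \sum_i phi i v.
have Phi_gt0 v : C v -> 0 < Phi v.
  move=> Cv; have [i vi] := net v Cv; rewrite /Phi (bigD1 i)//=.
  by rewrite ltr_pwDl ?sumr_ge0// lt_max subr_gt0 vi.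
have phi_cont i : continuous (phi i).
  move=> v; apply: (@continuous_max R X (fun v => e - `|v - y i|) (fun=> 0));
    last exact: cvg_cst.
  apply: cvgB; first exact: cvg_cst.
  by apply: cvg_norm; apply: cvgB; [exact: cvg_id|exact: cvg_cst].
pose p (x : 'rV[R]_n.+1) := \sum_i x ord0 i *: y i.
have Kp x : simplex x -> K (p x).
  by move=> Sx; apply: convex_set_combination => // i; exact: CK.
have p_cont : continuous p.
  move=> x; apply: (cvg_big add_continuous); first exact: nbhs_filter.
  by move=> i _; apply: (@cvgZr_tmp _ _ _ _ (nbhs_filter x));
    exact: coord_continuous.
pose f x : 'rV[R]_n.+1 := \row_i (phi i (G (p x)) / Phi (G (p x))).
have fS : set_fun (@simplex R n) (@simplex R n) f.
  move=> x Sx; have PG : 0 < Phi (G (p x)) by apply: Phi_gt0; exact/GC/Kp.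
  split=> [i|]; first by rewrite mxE divr_ge0// ltW.
  under eq_bigr do rewrite mxE.
  by rewrite -mulr_suml divff// gt_eqF.
have fc : {within @simplex R n, continuous f}.
  apply/subspace_continuousP => x Sx; apply/cvgrPdist_lt => d d0.
  have Gp : G (p z) @[z --> within (@simplex R n) (nbhs x)] --> G (p x).
    have /subspace_continuousP/(_ (p x) (Kp x Sx)) Gx := Gcont.
    apply: (cvg_comp _ _ _ Gx) => A KA.
    apply: (@filterS _ _ (nbhs_filter x) _ _ _ (p_cont x _ KA)) => z h Sz.
    exact/h/Kp.
  have fi i : phi i (G (p z)) / Phi (G (p z))
      @[z --> within (@simplex R n) (nbhs x)] -->
      phi i (G (p x)) / Phi (G (p x)).
    apply: cvgM; first exact: (cvg_comp _ _ Gp (phi_cont i _)).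
    apply: cvgV; first by rewrite gt_eqF// Phi_gt0//; exact/GC/Kp.
    apply: (cvg_big add_continuous) => j _.
    exact: (cvg_comp _ _ Gp (phi_cont j _)).
  have : \forall z \near within (@simplex R n) (nbhs x), forall i,
      `|f x ord0 i - f z ord0 i| < d.
    apply: filter_forall => i; rewrite mxE.
    under eq_near do rewrite mxE.
    exact: cvgr_dist_lt (fi i) _ d0.
  by apply: filterS => z h; apply/rV_norm_ltP => // i; rewrite !mxE;
    have := h i; rewrite !mxE.
have [x Sx fx] := brouwer_simplex fS fc.
exists (p x); first exact: Kp.
have Cv : C (G (p x)) by exact/GC/Kp.
set v := G (p x) in Cv *.
have -> : p x - v = \sum_i x ord0 i *: (y i - v).
  under eq_bigr do rewrite scalerBr.
  by rewrite sumrB -scaler_suml Sx.2 scale1r.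
apply: le_trans (ler_norm_sum _ _ _) _.
rewrite -[leRHS]mul1r -Sx.2 mulr_suml; apply: ler_sum => i _.
rewrite normrZ (ger0_norm (Sx.1 i)).
have [le|gt] := leP `|y i - v| e; first by rewrite ler_wpM2l// Sx.1.
suff -> : x ord0 i = 0 by rewrite !mul0r.
rewrite -fx mxE -/v /phi distrC max_r ?mul0r//.
by rewrite subr_le0 ltW.
Qed.

Theorem schauder : exists2 x, K x & G x = x.
Proof.
apply: contrapT => nofix.
(* Indexed by the value [y = G x], since the values, and not the points [x], are known to stay in
   the compact set [C]. *)
pose P (e : R) (y : X) := forall x, K x -> G x = y -> e < `|x - y|.
have : \forall e \near 0^'+, C `<=` P e.
  have /compact_near_coveringP := Ccompact; apply => y Cy.
  have Ky := CK Cy.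
  pose eta := `|G y - y|.
  have eta0 : 0 < eta.
    rewrite normr_gt0 subr_eq0; apply/eqP => Gy; apply: nofix; by exists y.
  have /within_continuous_normP/(_ y Ky (eta / 2)) := Gcont.
  case=> [|r r0 hr]; first lra.
  (* If [G x = y'] is within [d] of [y] and [x] within [r / 2] of [y'], then [x] is within [r] of
     [y], and [G x] is within [eta / 2] of both [G y] and [y], which are [eta] apart. *)
  pose d := Num.min (r / 2) (eta / 2).
  have d0 : 0 < d by rewrite lt_min; apply/andP; split; lra.
  exists ([set y' | `|y - y'| < d], [set e | e < r / 2]).
    split; first exact: nbhs_dist_lt.
    by apply: nbhs_right_lt; lra.
  move=> [y' e] /= [yy' er] x Kx Gx; rewrite ltNge; apply/negP => xy'.
  have [yr ye] : `|y - y'| < r / 2 /\ `|y - y'| < eta / 2.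
    by move: yy'; rewrite lt_min => /andP.
  have yx : `|y - x| < r.
    rewrite -(subrKA y') (le_lt_trans (ler_normD _ _))// (distrC y'); lra.
  have := hr x Kx yx; rewrite Gx => h.
  have : eta < eta; last by rewrite ltxx.
  rewrite {1}/eta -(subrKA y') (le_lt_trans (ler_normD _ _))// (distrC y').
  lra.
move=> [d /= d0 hd].
have d20 : 0 < d / 2 by lra.
have [x Kx xG] := schauder_approx d20.
have := hd (d / 2) _ d20 (G x) (GC Kx) x Kx erefl.
rewrite ltNge xG => /(_ _)/negP; case=> //=.
by rewrite sub0r normrN gtr0_norm//; lra.
Qed.

End schauder.

(** * The Nehari retraction *)

Lemma within_continuous_comp (R : realType) (U V W : normedModType R)
    (A : set U) (B : set V) (f : U -> V) (g : V -> W) :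
  set_fun A B f -> {within A, continuous f} -> {within B, continuous g} ->
  {within A, continuous (g \o f)}.
Proof.
move=> AB /within_continuous_normP fc /within_continuous_normP gc.
apply/within_continuous_normP => x Ax e e0.
have [d d0 hd] := gc _ (AB _ Ax) e e0; have [d' d'0 hd'] := fc x Ax d d0.
by exists d' => // y Ay xy; apply: hd; [exact: AB|exact: hd'].
Qed.

Section nehari.
Variables (R : realType) (X : normedModType R).
Variables (K : set X) (T : X -> X) (F : X * X -> R) (s : X -> R) (m M : R).
Hypothesis KZ : forall (l : R) (u : X), 0 <= l -> K u -> K (l *: u).
Hypothesis TK : set_fun K K T.
Hypothesis Tcont : {within K, continuous T}.
Hypothesis Fcont : {within K `*` K, continuous F}.
Hypothesis Fzero : forall (u : X) (l : R), (K `\ 0) u -> 0 < l ->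
  F (l *: u, u) = 0 <-> l = 1.
Hypothesis c1 : forall u : X, (K `\ 0) u ->
  unique (fun t : R => 0 < t /\ F (T (t *: u), t *: u) = 0) (s u).
Hypothesis m_gt0 : 0 < m.
Hypothesis s_bound : forall u, cone_sphere K u -> m < s u < M.

Lemma nehari_gt0 u : (K `\ 0) u -> 0 < s u.
Proof. by move=> /c1[[]]. Qed.

Lemma nehari_eq u t : (K `\ 0) u -> 0 < t -> F (T (t *: u), t *: u) = 0 ->
  s u = t.
Proof. by move=> /c1[_ +] t0 Ft; apply. Qed.

Lemma nehariZ u a : (K `\ 0) u -> 0 < a -> s (a *: u) = s u / a.
Proof.
move=> Ku a0; have [Ku' /eqP u0] := Ku; have [[s0 Fs] _] := c1 Ku.
apply: nehari_eq; first split.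
- by apply: KZ => //; exact: ltW.
- by apply/eqP; rewrite scaler_eq0 negb_or gt_eqF.
- exact: divr_gt0.
- by rewrite scalerA divfK// gt_eqF.
Qed.

(** By [nehariZ] the product is the value of [s] at the unit vector along [u]. *)
Lemma nehari_bound u : (K `\ 0) u -> m < s u * `|u| < M.
Proof.
move=> Ku; have [Ku' /eqP u0] := Ku; have nu : 0 < `|u| by rewrite normr_gt0.
have := @s_bound (`|u|^-1 *: u); rewrite nehariZ ?invr_gt0// invrK; apply.
split; first by apply: KZ => //; rewrite invr_ge0.
by rewrite normrZ normfV normr_id mulVf// gt_eqF.
Qed.

Lemma nehari_fixpoint u : (K `\ 0) u -> T u = u -> s u = 1.
Proof.
by move=> Ku Tu; apply: nehari_eq; rewrite // !scale1r Tu -{1}[u]scale1r;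
  apply/Fzero.
Qed.

(** Stated jointly in [t'] and [v], the form that compactness as near-covering asks for. *)
Lemma nehari_near t u : 0 < t -> K u -> F (T (t *: u), t *: u) != 0 ->
  \forall t' \near t & v \near u, 0 <= t' -> K v ->
    F (T (t' *: v), t' *: v) != 0.
Proof.
move=> t0 Ku; set q := t *: u => F0.
have Kq : K q by apply: KZ => //; exact: ltW.
have e0 : 0 < `|F (T q, q)| by rewrite normr_gt0.
have /within_continuous_normP/(_ (T q, q) (conj (TK Kq) Kq) _ e0) := Fcont.
case=> d d0 hF.
have /within_continuous_normP/(_ q Kq d d0)[d' d'0 hT] := Tcont.
have dd0 : 0 < Num.min d d' by rewrite lt_min d0.
have : nbhs (t, u) ((fun z : R * X => z.1 *: z.2) @^-1`
    [set y | `|q - y| < Num.min d d']).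
  exact/(@scale_continuous _ _ (t, u))/nbhs_dist_lt.
apply: filterS => -[t' v] /=; rewrite lt_min => /andP[h h'] t'0 Kv.
have Kt'v : K (t' *: v) by exact: KZ.
have := hF (T (t' *: v), t' *: v) (conj (TK Kt'v) Kt'v).
rewrite prod_normE/= gt_max h andbT hT// => /(_ isT).
by apply: contraTneq => ->; rewrite subr0 ltxx.
Qed.

(** For [v] near [u], [s v] stays in a compact interval. On the part of it at distance at least [e]
    from [s u], uniqueness gives nonvanishing of [F] along the ray of [u], which persists uniformly
    for [v] near [u]; so [s v] is not there. *)
Lemma nehari_cvg u : (K `\ 0) u -> s v @[v --> within K (nbhs u)] --> s u.
Proof.
move=> Ku; have [Ku' /eqP u0] := Ku; have nu : 0 < `|u| by rewrite normr_gt0.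
apply/cvgrPdist_lt => e e0.
(* The bounds of [nehari_bound] once the norm of [v] lies between half and twice that of [u]. *)
pose lo := m / (2 * `|u|); pose hi := M / (`|u| / 2).
have lo0 : 0 < lo by rewrite divr_gt0// mulr_gt0.
pose A := `[lo, hi]%classic `&` [set t | e <= `|s u - t|].
have Ac : compact A.
  apply: compact_closedI; first exact: segment_compact.
  apply: (@preimage_closed _ _ (fun t => `|s u - t|) [set r | e <= r]);
    last exact: closed_ge.
  by move=> t _; apply: cvg_norm; apply: cvgB; [exact: cvg_cst|exact: cvg_id].
have hA : \forall v \near u, A `<=` [set t | 0 <= t -> K v ->
    F (T (t *: v), t *: v) != 0].
  have /compact_near_coveringP := Ac; apply => t [/= + est].
  rewrite in_itv/= => /andP[lot _].
  have t0 : 0 < t by exact: lt_le_trans lot.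
  apply: nehari_near => //; apply/eqP => /(nehari_eq Ku t0) st.
  by move: est; rewrite st subrr normr0 leNgt e0.
have nu2 : 0 < `|u| / 2 by lra.
apply: filterS2 hA (nbhs_dist_lt u nu2) => v hv uv Kv.
have /andP[v1 v2] : `|u| / 2 < `|v| < 2 * `|u|.
  have := le_lt_trans (ler_dist_dist u v) uv.
  by rewrite ltr_distlC; lra.
have Kv0 : (K `\ 0) v by split=> //; apply/eqP; rewrite -normr_gt0; lra.
have sv0 := nehari_gt0 Kv0.
have /andP[b1 b2] := nehari_bound Kv0.
rewrite ltNge; apply/negP => se.
have Av : A (s v).
  split=> //=; rewrite in_itv/=; apply/andP; split.
    rewrite /lo ler_pdivrMr ?mulr_gt0//; apply: ltW (lt_trans b1 _).
    by rewrite ltr_pM2l.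
  rewrite /hi ler_pdivlMr//; apply: ltW (lt_trans _ b2).
  by rewrite ltr_pM2l.
have := hv _ Av (ltW sv0) Kv; have [[_ ->] _] := c1 Kv0.
by rewrite eqxx.
Qed.

(** On each ray, fixes the segment from [0] to the point [s v *: v] and sends everything beyond to
    that point. The arbitrary value [s 0] is harmless, as it multiplies [0]. *)
Definition nehari_retract (v : X) : X := Num.min 1 (s v) *: v.

Lemma nehari_retract_in : set_fun K K nehari_retract.
Proof.
move=> v Kv; have [v0|/eqP v0] := eqVneq v 0.
  by rewrite /nehari_retract v0 scaler0 -(scale0r v); exact: KZ.
by apply: KZ => //; rewrite le_min ler01 ltW// nehari_gt0.
Qed.

(** Serves for continuity at [0], where [nehari_cvg] says nothing. *)
Lemma nehari_retract_le v : K v -> `|nehari_retract v| <= `|v|.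
Proof.
move=> Kv; have [v0|/eqP v0] := eqVneq v 0.
  by rewrite /nehari_retract v0 scaler0.
have sv := nehari_gt0 (conj Kv v0 : (K `\ 0) v).
rewrite normrZ ler_piMl// ger0_norm ?ge_min ?lexx//.
by rewrite le_min ler01 ltW.
Qed.

Lemma nehari_retract_bound v : K v -> `|nehari_retract v| <= `|M|.
Proof.
move=> Kv; have [v0|/eqP v0] := eqVneq v 0.
  by rewrite /nehari_retract v0 scaler0 normr0.
have Kv0 : (K `\ 0) v by [].
have sv := nehari_gt0 Kv0; have /andP[_ /ltW b] := nehari_bound Kv0.
apply: le_trans (ler_norm M); apply: le_trans b.
rewrite normrZ ler_wpM2r// ger0_norm ?ge_min ?lexx ?orbT//.
by rewrite le_min ler01 ltW.
Qed.

Lemma nehari_retract_continuous : {within K, continuous nehari_retract}.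
Proof.
apply/subspace_continuousP => v Kv; have [v0|/eqP v0] := eqVneq v 0.
  have r0 : nehari_retract v = 0 by rewrite /nehari_retract v0 scaler0.
  rewrite /from_subspace r0; apply/cvgrPdist_lt => e e0.
  apply: filterS (nbhs_dist_lt v e0) => w; rewrite /= v0 => + Kw.
  rewrite !sub0r !normrN.
  exact/le_lt_trans/nehari_retract_le.
apply: cvgZ; last exact/cvg_within.
have Kv0 : (K `\ 0) v by [].
apply: (cvg_comp _ _ (nehari_cvg Kv0)).
exact: (@continuous_min R R (fun=> 1) id (s v) (cvg_cst _) (cvg_id)).
Qed.

(* If the retraction moves [v], then [u := s v *: v] lies on the Nehari set and
   [T u] is a multiple of [u], which [F] forbids. *)
Lemma nehari_retract_fixpoint v : K v -> T (nehari_retract v) = v -> T v = v.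
Proof.
rewrite /nehari_retract => Kv.
have [v0|/eqP v0] := eqVneq v 0; first by rewrite v0 scaler0.
have Kv0 : (K `\ 0) v by [].
have [_|sv1] := leP 1 (s v); first by rewrite scale1r.
move=> Tv; exfalso; have [[s0 Fs] _] := c1 Kv0.
move: Fs; rewrite Tv -{1}[v](scalerK (lt0r_neq0 s0)).
have Ku : (K `\ 0) (s v *: v).
  split; first by apply: KZ => //; exact: ltW.
  by apply/eqP; rewrite scaler_eq0 negb_or gt_eqF//; exact/eqP.
have si0 : 0 < (s v)^-1 by rewrite invr_gt0.
move=> /(Fzero Ku si0) /eqP; rewrite invr_eq1 => /eqP s1.
by move: sv1; rewrite s1 ltxx.
Qed.

End nehari.

Theorem corollary2p7 (R : realType) (X : completeNormedModType R)
    (K : set X) (T : X -> X) (F : X * X -> R) (s : X -> R) (m M : R)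
    (HK : nondegenerate_cone K)
    (TK : set_fun K K T)
    (Tcc : completely_continuous_on K T)
    (Fcont : {within K `*` K, continuous F})
    (Fzero : forall (u : X) (l : R), (K `\ 0) u -> 0 < l ->
       F (l *: u, u) = 0 <-> l = 1)
    (c1 : forall u : X, (K `\ 0) u ->
       unique (fun t : R => 0 < t /\ F (T (t *: u), t *: u) = 0) (s u))
    (m_gt0 : 0 < m) (m_lt_M : m < M)
    (c2_inf : (m%:E < ereal_inf [set (s u)%:E | u in cone_sphere K])%E)
    (c2_sup : (ereal_sup [set (s u)%:E | u in cone_sphere K] < M%:E)%E) :
  exists u : X, [/\ K u, T u = u & T 0 <> 0 -> s u = 1].
Proof.
have [Kclosed Kconv KZ [u0 [Ku0 _]]] := HK; have [Tcont Tcpt] := Tcc.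
have s_bound u : cone_sphere K u -> m < s u < M.
  move=> Su; rewrite -!lte_fin; apply/andP; split.
    by apply: lt_le_trans c2_inf _; apply: ereal_inf_lbound; exists u.
  by apply: le_lt_trans c2_sup; apply: ereal_sup_ubound; exists u.
pose rho := nehari_retract s.
have rhoK : set_fun K K rho := @nehari_retract_in _ _ K T F s KZ c1.
(* [rho] has bounded range, so complete continuity makes [C] compact, and closedness of [K] keeps
   [C] inside [K]. *)
pose C := closure (T @` (rho @` K)).
have Ccpt : compact C.
  rewrite /C -precompactE; apply: Tcpt.
    by move=> _ [v Kv <-]; exact: rhoK.
  exists `|M|; split; first exact: num_real.
  move=> r Mr _ [v Kv <-]; apply: le_trans (ltW Mr).
  exact: (@nehari_retract_bound _ _ K T F s m M).
have CK : C `<=` K.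
  rewrite [X in _ `<=` X](closure_id _).1//; apply: closure_subset.
  by move=> _ [_ [v Kv <-] <-]; exact/TK/rhoK.
have GC : set_fun K C (T \o rho).
  by move=> v Kv; apply: subset_closure; exists (rho v) => //; exists v.
have Gcont : {within K, continuous (T \o rho)}.
  apply: (within_continuous_comp rhoK _ Tcont).
  exact: (@nehari_retract_continuous _ _ K T F s m M).
have [v Kv Gv] := schauder Kconv (ex_intro _ _ Ku0) Ccpt CK GC Gcont.
have Tv : T v = v by exact: (@nehari_retract_fixpoint _ _ K T F s).
(* [T 0 <> 0] rules out [v = 0], as [T v = v]. *)
exists v; split=> // T0; apply: (@nehari_fixpoint _ _ K T F s) => //.
by split=> // v0; apply: T0; rewrite -v0.
Qed.
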